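(* For three agents the partition-based strategy is optimal: for any maximum speeds $v_1, v_2, v_3 > 0$ and any $l > (v_1 + v_2 + v_3)/2$, no strategy for three agents with maximum speeds $v_1, v_2, v_3$ patrols the fence $[0, l]$.
   Context: Fence patrolling: a fence is a segment $[0,l]$ with $l>0$. There are $k$ agents $a_1,\dots,a_k$ with given maximum speeds $v_1,\dots,v_k>0$. The motion of agent $a_i$ is a function $a_i\colon[0,\infty)\to[0,l]$ satisfying $|a_i(t)-a_i(t+\epsilon)|\le v_i\epsilon$ for all $t\ge 0$, $\epsilon>0$. Agents may move in both directions and may pass each other. A strategy is a $k$-tuple $(a_1,\dots,a_k)$ of such functions. Agent $a_i$ covers the pair $(x;t^* )$ if $a_i(t)=x$ for some $t\in[t^*-1,t^* )$. A strategy patrols $[0,l]$ if for every $x\in[0,l]$ and every $t^*\in[1,\infty)$ some agent $a_i$ covers $(x;t^* )$. The partition-based strategy splits $[0,l]$ into $k$ consecutive segments of lengths proportional to $v_1,\dots,v_k$, with agent $a_i$ moving back and forth at full speed between the endpoints of the $i$-th segment; it patrols a fence of length $(v_1+\dots+v_k)/2$. *)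

(* Defs.v *)
From Stdlib Require Import Reals Lra.
Open Scope R_scope.

Definition motion (l v : R) (a : R -> R) : Prop :=
  (forall t, 0 <= t -> 0 <= a t <= l) /\
  (forall t eps, 0 <= t -> 0 < eps -> Rabs (a t - a (t + eps)) <= v * eps).

Definition covers (a : R -> R) (x tstar : R) : Prop :=
  exists t, tstar - 1 <= t < tstar /\ a t = x.

Definition strategy (k : nat) (l : R) (v : nat -> R) (a : nat -> R -> R) : Prop :=
  forall i, (i < k)%nat -> motion l (v i) (a i).

Definition patrols (k : nat) (l : R) (a : nat -> R -> R) : Prop :=
  forall x tstar, 0 <= x <= l -> 1 <= tstar ->
    exists i, (i < k)%nat /\ covers (a i) x tstar.

(* Main.v *)
Require Import Defs.
From Stdlib Require Import Reals.
From Stdlib Require Import Lra Lia Psatz Classical.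
Open Scope R_scope.

(** Let f be the speed of the fastest agent F and g >= m those of G and M, and
    suppose that a fence of length L > (f + g + m) / 2 is patrolled.
    - G and M cannot both visit the same end within a unit of time, since some
      point at distance more than f / 2 from the other end would then be
      neglected. So while F is away from an end, a single slow agent guards it,
      and by the two-agent case F must keep visiting both ends.
    - When F travels from one end to the other, the agent guarding the end it
      left cannot also guard the end it is heading to, because
      L / f + L / v > 2 for v = g and v = m. So one slow agent guards each end.
    - If G is the guard of L and M that of 0, then during an excursion of F to
      L some point slightly beyond m / 2 must be visited by G, so F has to stay
      near L long enough to replace G; the time this takes leaves another point
      unvisited. Hence G guards 0 and M guards L, and the mirror image of the
      argument applies to the next excursion of F, from L to 0 and back. *)

(** * Lipschitz motions, quotients and hitting times *)

(** Required at all real times, so that motions can be reversed in time; [motion_extends_lip]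
    supplies the extension. *)
Definition lip (v : R) (a : R -> R) : Prop :=
  forall s t, Rabs (a s - a t) <= v * Rabs (s - t).

Definition avoids (a : R -> R) (x A B : R) : Prop :=
  forall w, A < w < B -> a w <> x.

Lemma div_gt c x v : 0 < v -> c * v < x -> c < x / v.
Proof.
  intros Hv H. apply Rmult_lt_reg_r with v; [exact Hv|].
  replace (x / v * v) with x by (field; lra). exact H.
Qed.

Lemma div_ge c x v : 0 < v -> c * v <= x -> c <= x / v.
Proof.
  intros Hv H. apply Rmult_le_reg_r with v; [exact Hv|].
  replace (x / v * v) with x by (field; lra). exact H.
Qed.

Lemma div_antimono x v w : 0 <= x -> 0 < v -> v <= w -> x / w <= x / v.
Proof.
  intros Hx Hv Hw. unfold Rdiv. apply Rmult_le_compat_l; [exact Hx|].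
  apply Rinv_le_contravar; assumption.
Qed.

Lemma ratio_sum_ge_2 a b : 0 < a -> 0 < b -> 2 <= a / b + b / a.
Proof.
  intros Ha Hb.
  assert (E : a / b + b / a - 2 = (a - b) ^ 2 / (a * b)) by (field; lra).
  assert (0 <= (a - b) ^ 2 / (a * b)); [|lra].
  apply Rmult_le_pos; [apply pow2_ge_0|].
  apply Rlt_le, Rinv_0_lt_compat; nra.
Qed.

Lemma div_sum_gt_2 a b D :
  0 < a -> 0 < b -> (a + b) / 2 < D -> 2 < D / a + D / b.
Proof.
  intros Ha Hb HD.
  pose proof (ratio_sum_ge_2 a b Ha Hb).
  assert (E : (a + b) / 2 / a + (a + b) / 2 / b = 1 + (a / b + b / a) / 2)
    by (field; lra).
  assert ((a + b) / 2 / a < D / a)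
    by (apply Rmult_lt_compat_r; [apply Rinv_0_lt_compat|]; lra).
  assert ((a + b) / 2 / b < D / b)
    by (apply Rmult_lt_compat_r; [apply Rinv_0_lt_compat|]; lra).
  lra.
Qed.

Lemma lip_opp v a c : lip v a -> lip v (fun t => c - a t).
Proof.
  intros H s t. replace (c - a s - (c - a t)) with (- (a s - a t)) by ring.
  rewrite Rabs_Ropp. apply H.
Qed.

(** Moving by [d] takes time at least [d / v]. Disjunctions replace absolute values so that [lra]
    can treat each case. *)
Lemma lip_separation v a s w d :
  0 < v -> lip v a -> d <= a w - a s \/ d <= a s - a w ->
  w <= s - d / v \/ s + d / v <= w.
Proof.
  intros Hv Ha Hd.
  assert (H : d / v <= Rabs (w - s)).
  { apply Rmult_le_reg_r with v; [exact Hv|].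
    replace (d / v * v) with d by (field; lra).
    pose proof (Ha w s) as H. rewrite Rmult_comm.
    revert H. unfold Rabs at 1. destruct Rcase_abs; lra. }
  revert H. unfold Rabs. destruct Rcase_abs; lra.
Qed.

Lemma last_hit v a x t u :
  0 < v -> lip v a -> t <= u -> a t = x ->
  exists s, t <= s <= u /\ a s = x /\ forall w, s < w <= u -> a w <> x.
Proof.
  intros Hv Ha Htu Hat.
  destruct (completeness (fun s => t <= s <= u /\ a s = x)) as [s [Hub Hlub]].
  - exists u. intros s [H _]. lra.
  - exists t. split; [lra|exact Hat].
  - assert (Hts : t <= s) by (apply Hub; split; [lra|exact Hat]).
    assert (Hsu : s <= u) by (apply Hlub; intros w [H _]; lra).
    exists s. split; [lra|]. split.
    + apply NNPP. intros Hne.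
      (* Were [a s] at distance [e > 0] from [x], no hit could lie within [e / v] before [s], and
         [s - e / v] would be a smaller upper bound. *)
      set (e := Rabs (a s - x)).
      assert (He : 0 < e) by (apply Rabs_pos_lt; lra).
      assert (Hev : 0 < e / v) by (apply Rdiv_lt_0_compat; assumption).
      assert (Hs : s <= s - e / v); [|lra].
      apply Hlub. intros w [Hw Haw].
      assert (Hws : w <= s) by (apply Hub; split; assumption).
      destruct (lip_separation v a w s e) as [H|H]; [assumption|assumption| |lra|lra].
      unfold e, Rabs. destruct Rcase_abs; [right|left]; lra.
    + intros w Hw Haw. assert (w <= s); [|lra].
      apply Hub. split; [lra|exact Haw].
Qed.

Lemma first_hit v a x t u :
  0 < v -> lip v a -> t <= u -> a u = x ->
  exists s, t <= s <= u /\ a s = x /\ forall w, t <= w < s -> a w <> x.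
Proof.
  intros Hv Ha Htu Hau.
  destruct (last_hit v (fun s => a (- s)) x (- u) (- t)) as [s [Hs [Has Hl]]].
  - exact Hv.
  - intros p q. replace (Rabs (p - q)) with (Rabs (- p - - q)); [apply Ha|].
    rewrite <- Rabs_Ropp. f_equal. ring.
  - lra.
  - rewrite Ropp_involutive. exact Hau.
  - exists (- s). split; [lra|]. split; [exact Has|].
    intros w Hw. specialize (Hl (- w)). rewrite Ropp_involutive in Hl.
    apply Hl. lra.
Qed.

(** * The two-agent case *)

Lemma transit v a x y t u :
  0 < v -> lip v a -> t <= u -> a t = x -> a u = y -> x <> y ->
  exists t' u', t <= t' < u' /\ u' <= u /\ a t' = x /\ a u' = y /\
    forall w, t' < w < u' -> a w <> x /\ a w <> y.
Proof.
  intros Hv Ha Htu Hat Hau Hxy.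
  destruct (first_hit v a y t u) as [u' [Hu' [Hau' Hf]]]; auto.
  destruct (last_hit v a x t u') as [t' [Ht' [Hat' Hl]]]; auto; [lra|].
  exists t', u'.
  assert (t' <> u') by congruence.
  split; [lra|]. split; [lra|]. split; [exact Hat'|]. split; [exact Hau'|].
  intros w Hw. split; [apply Hl|apply Hf]; lra.
Qed.

(* While A travels from x0 to x1, B must be at x1 at a time in [u - 1, u), and
   the absence from x0 that this forces on B overlaps that of A for more than
   a unit of time because D / a + D / b > 2. *)
Lemma no_shadowed_transit a b x0 x1 A B t u :
  0 < a -> 0 < b -> (a + b) / 2 < x1 - x0 -> lip a A -> lip b B ->
  t < u -> A t = x0 -> A u = x1 ->
  (forall w, t < w < u -> A w <> x0 /\ A w <> x1) ->
  (forall T, t < T - 1 -> T <= u + (x1 - x0) / a ->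
     exists w, T - 1 <= w < T /\ (A w = x0 \/ B w = x0)) ->
  (exists w, u - 1 <= w < u /\ (A w = x1 \/ B w = x1)) -> False.
Proof.
  intros Ha Hb HD HA HB Htu HAt HAu Hno cov0 [r [Hr Hr1]].
  set (D := x1 - x0) in *.
  assert (Ea : / 2 < D / a) by (apply div_gt; lra).
  assert (Eb : / 2 < D / b) by (apply div_gt; lra).
  pose proof (div_sum_gt_2 a b D Ha Hb HD) as Eab.
  assert (Hlen : t + D / a <= u).
  { destruct (lip_separation a A t u D); auto; unfold D in *; lra. }
  assert (HBr : B r = x1).
  { destruct Hr1 as [H|H]; [|exact H]. exfalso.
    destruct (lip_separation a A t r D); auto; [unfold D; lra|lra|].
    destruct (Hno r) as [_ Hn]; [lra|exact (Hn H)]. }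
  destruct (cov0 (Rmin (r + D / b) (u + D / a))) as [w [Hw Hw0]].
  - unfold Rmin; destruct Rle_dec; lra.
  - apply Rmin_r.
  - pose proof (Rmin_l (r + D / b) (u + D / a)).
    pose proof (Rmin_r (r + D / b) (u + D / a)).
    assert (Hlow : t < w /\ r - D / b < w)
      by (revert Hw; unfold Rmin; destruct Rle_dec; lra).
    destruct Hw0 as [Hw0|Hw0].
    + destruct (lip_separation a A u w D); auto; [unfold D; lra| |lra].
      destruct (Hno w) as [Hn _]; [lra|exact (Hn Hw0)].
    + destruct (lip_separation b B r w D); auto; [unfold D; lra|lra|lra].
Qed.

(** If A stayed away from [x0], B would be tied to [x0] and kept below [y], so A alone would have to
    serve both [y] and [x1]. *)
Lemma two_agents_visit_end a b x0 x1 A B S :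
  0 < a -> 0 < b -> (a + b) / 2 < x1 - x0 -> lip a A -> lip b B ->
  (forall x T, x0 <= x <= x1 -> S <= T <= S + 2 ->
     exists w, T - 1 <= w < T /\ (A w = x \/ B w = x)) ->
  exists w, S - 1 <= w <= S + 2 /\ A w = x0.
Proof.
  intros Ha Hb HD HA HB cov. apply NNPP. intros Hno.
  assert (HnoA : forall w, S - 1 <= w <= S + 2 -> A w <> x0)
    by (intros w Hw H; apply Hno; exists w; auto).
  (* A quarter of the doubled surplus: [y] is at distance [b / 2 + e] from [x0] and [a / 2 + e] from
     [x1]. *)
  set (e := (x1 - x0 - (a + b) / 2) / 2).
  set (y := x0 + b / 2 + e).
  assert (He : 0 < e) by (unfold e; lra).
  assert (HnoB : forall w, S - / 2 <= w <= S + 3 / 2 -> B w < y).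
  { intros w Hw. apply Rnot_le_lt. intros Hy.
    destruct (cov x0 (w + / 2)) as [w' [Hw' [H|H]]]; [lra|lra| |].
    - apply (HnoA w'); [lra|exact H].
    - assert (/ 2 < (b / 2 + e) / b) by (apply div_gt; lra).
      destruct (lip_separation b B w w' (b / 2 + e)); auto;
        [unfold y in *; lra|lra|lra]. }
  destruct (cov x1 (S + 1)) as [w [Hw [H|H]]]; [lra|lra| |].
  - destruct (cov y (w + / 2)) as [w' [Hw' [H'|H']]].
    + unfold y, e; lra.
    + lra.
    + assert (/ 2 < (a / 2 + e) / a) by (apply div_gt; lra).
      destruct (lip_separation a A w w' (a / 2 + e)); auto;
        [unfold y, e in *; lra|lra|lra].
    + assert (B w' < y) by (apply HnoB; lra). lra.
  - assert (B w < y) by (apply HnoB; lra). unfold y, e in *; lra.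
Qed.

(** A visits [x0] and later, by reflection, [x1]; the transit in between contradicts
    [no_shadowed_transit]. Coverage is asked only for a bounded time, so that the result applies
    while a third agent is tied to an end. *)
Lemma two_agents_cannot_patrol a b x0 x1 A B S :
  0 < a -> 0 < b -> (a + b) / 2 < x1 - x0 -> lip a A -> lip b B ->
  (forall x T, x0 <= x <= x1 -> S <= T <= S + 6 + (x1 - x0) / a ->
     exists w, T - 1 <= w < T /\ (A w = x \/ B w = x)) -> False.
Proof.
  intros Ha Hb HD HA HB cov.
  assert (Ea : / 2 < (x1 - x0) / a) by (apply div_gt; lra).
  destruct (two_agents_visit_end a b x0 x1 A B (S + 1)) as [t0 [Ht0 HAt0]]; auto.
  { intros x T Hx HT. apply cov; lra. }
  destruct (two_agents_visit_end a b (- x1) (- x0)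
    (fun t => 0 - A t) (fun t => 0 - B t) (S + 4)) as [u0 [Hu0 HAu0]]; auto.
  { lra. } { apply lip_opp, HA. } { apply lip_opp, HB. }
  { intros x T Hx HT. destruct (cov (- x) T) as [w [Hw H]]; [lra|lra|].
    exists w. split; [exact Hw|]. destruct H; [left|right]; lra. }
  destruct (transit a A x0 x1 t0 u0) as [t [u [Htu [Hu [HAt [HAu Hno]]]]]]; auto;
    [lra|lra|lra|].
  assert (t + (x1 - x0) / a <= u).
  { destruct (lip_separation a A t u (x1 - x0)); auto; lra. }
  apply (no_shadowed_transit a b x0 x1 A B t u); auto; [lra| |].
  - intros T HT1 HT2. apply cov; lra.
  - apply cov; lra.
Qed.

(** * Three agents: symmetries and the single slow visitor of an end *)

Record patrolling (L f g m : R) (F G M : R -> R) : Prop := {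
  pos_f : 0 < f; pos_g : 0 < g; pos_m : 0 < m;
  le_gf : g <= f; le_mf : m <= f;
  long : (f + g + m) / 2 < L;
  lip_F : lip f F; lip_G : lip g G; lip_M : lip m M;
  cov : forall x T, 0 <= x <= L -> 1 <= T ->
    exists w, T - 1 <= w < T /\ (F w = x \/ G w = x \/ M w = x) }.

Lemma patrolling_swap L f g m F G M :
  patrolling L f g m F G M -> patrolling L f m g F M G.
Proof.
  intros []. constructor; auto; [lra|].
  intros x T Hx HT. destruct (cov0 x T Hx HT) as [w [Hw H]].
  exists w. tauto.
Qed.

Lemma patrolling_reflect L f g m F G M :
  patrolling L f g m F G M ->
  patrolling L f g m (fun t => L - F t) (fun t => L - G t) (fun t => L - M t).
Proof.
  intros []. constructor; auto using lip_opp.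
  intros x T Hx HT. destruct (cov0 (L - x) T) as [w [Hw H]]; [lra|lra|].
  exists w. split; [exact Hw|].
  destruct H as [H|[H|H]]; [left|right; left|right; right]; lra.
Qed.

(* At y = (g + m) / 2 + e, at distance more than f / 2 from L, the agents G and
   M are absent around s and p, and a visit of F to y would leave L unvisited
   for a unit of time. *)
Lemma slow_visits_far_apart L f g m F G M s p :
  patrolling L f g m F G M -> 2 <= s -> 2 <= p ->
  s - 1 <= p <= s + 1 -> G s = 0 -> M p = 0 -> False.
Proof.
  intros P Hs2 Hp2 Hsp HGs HMp. destruct P.
  set (y := (g + m) / 2 + (L - (f + g + m) / 2) / 2).
  assert (Hy : (g + m) / 2 < y) by (unfold y; lra).
  assert (HyL : f / 2 < L - y) by (unfold y; lra).
  assert (E1 : / 2 < y / g) by (apply div_gt; lra).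
  assert (E2 : / 2 < y / m) by (apply div_gt; lra).
  pose proof (div_sum_gt_2 g m y pos_g0 pos_m0 Hy) as E3.
  assert (E4 : / 2 < (L - y) / f) by (apply div_gt; lra).
  assert (E5 : y / g + / 2 < L / g).
  { replace (L / g) with (y / g + (L - y) / g) by (field; lra).
    assert (/ 2 < (L - y) / g) by (apply div_gt; lra). lra. }
  assert (E6 : y / m + / 2 < L / m).
  { replace (L / m) with (y / m + (L - y) / m) by (field; lra).
    assert (/ 2 < (L - y) / m) by (apply div_gt; lra). lra. }
  destruct (cov0 y (Rmin (s + y / g) (p + y / m))) as [w [Hw H]].
  { lra. }
  { unfold Rmin; destruct Rle_dec; lra. }
  assert (Hw' : s - y / g < w < s + y / g /\ p - y / m < w < p + y / m)
    by (revert Hw; unfold Rmin; destruct Rle_dec; lra).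
  assert (1 <= w) by (revert Hw; unfold Rmin; destruct Rle_dec; lra).
  destruct H as [H|[H|H]].
  - destruct (cov0 L (w + / 2)) as [w' [Hw1 [H'|[H'|H']]]]; [lra|lra| | |].
    + destruct (lip_separation f F w w' (L - y)); auto; lra.
    + destruct (lip_separation g G s w' L); auto; lra.
    + destruct (lip_separation m M p w' L); auto; lra.
  - destruct (lip_separation g G s w y); auto; lra.
  - destruct (lip_separation m M p w y); auto; lra.
Qed.

(** From the last visit of G to the first later one of M nobody is at 0, so the two are at most one
    unit apart, against [slow_visits_far_apart]. *)
Lemma slow_visits_not_mixed L f g m F G M A B w1 w2 :
  patrolling L f g m F G M -> 2 <= A -> avoids F 0 A B ->
  A < w1 -> w1 <= w2 -> w2 < B -> G w1 = 0 -> M w2 = 0 -> False.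
Proof.
  intros P HA HF Hw1 H12 Hw2 HG HM.
  destruct (last_hit g G 0 w1 w2) as [s [Hs [HGs Hl]]];
    eauto using pos_g, lip_G.
  destruct (first_hit m M 0 s w2) as [p [Hp [HMp Hf]]];
    eauto using pos_m, lip_M; [lra|].
  apply (slow_visits_far_apart L f g m F G M s p); auto; [lra|lra|].
  split; [lra|]. apply Rnot_lt_le. intros Hgap.
  destruct (cov _ _ _ _ _ _ _ P 0 p) as [w [Hw [H|[H|H]]]].
  - destruct P. lra.
  - lra.
  - apply (HF w); [lra|exact H].
  - apply (Hl w); [lra|exact H].
  - apply (Hf w); [lra|exact H].
Qed.

Lemma one_slow_visitor L f g m F G M A B :
  patrolling L f g m F G M -> 2 <= A -> avoids F 0 A B ->
  avoids G 0 A B \/ avoids M 0 A B.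
Proof.
  intros P HA HF.
  destruct (classic (avoids G 0 A B)) as [H|HG]; [left; exact H|].
  right. intros w2 Hw2 HM. apply HG. intros w1 Hw1 HG1.
  destruct (Rle_lt_dec w1 w2).
  - apply (slow_visits_not_mixed L f g m F G M A B w1 w2); auto; lra.
  - apply (slow_visits_not_mixed L f m g F M G A B w2 w1); auto; try lra.
    apply patrolling_swap, P.
Qed.

Lemma reflect_avoids L a x A B :
  avoids (fun t => L - a t) (L - x) A B <-> avoids a x A B.
Proof.
  split; intros H w Hw E; apply (H w Hw); lra.
Qed.

Lemma one_slow_visitor_right L f g m F G M A B :
  patrolling L f g m F G M -> 2 <= A -> avoids F L A B ->
  avoids G L A B \/ avoids M L A B.
Proof.
  intros P HA HF.
  rewrite <- (reflect_avoids L G), <- (reflect_avoids L M).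
  replace (L - L) with 0 by ring.
  apply (one_slow_visitor L f g m (fun t => L - F t) (fun t => L - G t)
    (fun t => L - M t)); auto using patrolling_reflect.
  replace 0 with (L - L) by ring. apply reflect_avoids, HF.
Qed.

(** * The fastest agent keeps visiting both ends *)

(** Guarding 0 alone keeps M short of [y], slightly beyond [m / 2], so F and G would have to patrol
    the rest, which is longer than [(f + g) / 2]. *)
Lemma M_alone_at_end_bounded L f g m F G M S :
  patrolling L f g m F G M -> 2 <= S ->
  avoids F 0 S (S + 10 + L / f) -> avoids G 0 S (S + 10 + L / f) -> False.
Proof.
  intros P HS HF HG. destruct P.
  set (y := m / 2 + (L - (f + g + m) / 2) / 2).
  assert (Hy : m / 2 < y) by (unfold y; lra).
  assert (E : / 2 < y / m) by (apply div_gt; lra).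
  assert (Ey : (L - y) / f <= L / f).
  { apply Rmult_le_compat_r; [apply Rlt_le, Rinv_0_lt_compat|]; lra. }
  apply (two_agents_cannot_patrol f g y L F G (S + 2)); auto.
  { unfold y; lra. }
  intros x T Hx HT.
  destruct (cov0 x T) as [w [Hw [H|[H|H]]]]; [lra|lra| | |].
  - exists w; auto.
  - exists w; auto.
  - exfalso.
    destruct (cov0 0 (w + / 2)) as [w' [Hw' [H'|[H'|H']]]]; [lra|lra| | |].
    + apply (HF w'); [lra|exact H'].
    + apply (HG w'); [lra|exact H'].
    + destruct (lip_separation m M w w' y); auto; lra.
Qed.

Lemma F_visits_left L f g m F G M S :
  patrolling L f g m F G M -> 2 <= S ->
  exists w, S < w < S + 10 + L / f /\ F w = 0.
Proof.
  intros P HS. apply NNPP. intros Hno.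
  assert (HF : avoids F 0 S (S + 10 + L / f))
    by (intros w Hw H; apply Hno; exists w; auto).
  destruct (one_slow_visitor L f g m F G M _ _ P HS HF).
  - apply (M_alone_at_end_bounded L f g m F G M S); auto.
  - apply (M_alone_at_end_bounded L f m g F M G S); auto using patrolling_swap.
Qed.

Lemma F_visits_right L f g m F G M S :
  patrolling L f g m F G M -> 2 <= S ->
  exists w, S < w < S + 10 + L / f /\ F w = L.
Proof.
  intros P HS.
  destruct (F_visits_left L f g m _ _ _ S (patrolling_reflect _ _ _ _ _ _ _ P) HS)
    as [w [Hw H]].
  exists w. split; [exact Hw|lra].
Qed.

(** * Excursions of F from one end to the other and back *)

(** Between [u] and [u'] F may leave [L] and come back to it. *)
Record excursion (F : R -> R) (L t u u' t' : R) : Prop := {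
  exc_tu : t < u; exc_uu : u <= u'; exc_ut : u' < t';
  exc_t : F t = 0; exc_u : F u = L; exc_u' : F u' = L; exc_t' : F t' = 0;
  exc_left : avoids F 0 t t';
  exc_right1 : avoids F L t u; exc_right2 : avoids F L u' t' }.

Lemma excursion_exists v F L t0 u0 t1 :
  0 < v -> lip v F -> 0 < L -> t0 < u0 < t1 ->
  F t0 = 0 -> F u0 = L -> F t1 = 0 ->
  exists t u u' t', excursion F L t u u' t' /\ t0 <= t /\ t < u0 < t' /\ t' <= t1.
Proof.
  intros Hv HF HL Ht Ht0 Hu0 Ht1.
  destruct (last_hit v F 0 t0 u0) as [t [Ht' [HFt Hlt]]]; auto; [lra|].
  destruct (first_hit v F 0 u0 t1) as [t' [Ht'' [HFt' Hft]]]; auto; [lra|].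
  destruct (first_hit v F L t u0) as [u [Hu [HFu Hfu]]]; auto; [lra|].
  destruct (last_hit v F L u0 t') as [u' [Hu' [HFu' Hlu]]]; auto; [lra|].
  assert (t <> u) by (intros ->; lra).
  assert (u' <> t') by (intros ->; lra).
  exists t, u, u', t'. split; [constructor; auto; try lra|lra].
  - intros w Hw. destruct (Rle_lt_dec w u0); [apply Hlt|apply Hft]; lra.
  - intros w Hw. apply Hfu; lra.
  - intros w Hw. apply Hlu; lra.
Qed.

Lemma excursion_lengths v F L t u u' t' :
  0 < v -> lip v F -> 0 < L -> excursion F L t u u' t' ->
  t + L / v <= u /\ u' + L / v <= t'.
Proof.
  intros Hv HF HL [].
  assert (0 < L / v) by (apply Rdiv_lt_0_compat; assumption).
  split.
  - destruct (lip_separation v F t u L); auto; lra.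
  - destruct (lip_separation v F u' t' L); auto; lra.
Qed.

Lemma excursion_avoids v F L t u u' t' :
  0 < v -> lip v F -> 0 < L -> excursion F L t u u' t' ->
  avoids F L (t - L / v) u /\ avoids F L u' (t' + L / v).
Proof.
  intros Hv HF HL E. destruct (excursion_lengths _ _ _ _ _ _ _ Hv HF HL E).
  assert (0 < L / v) by (apply Rdiv_lt_0_compat; assumption).
  destruct E. split; intros w Hw Hhit.
  - destruct (lip_separation v F t w L); auto; [lra|lra|].
    apply (exc_right3 w); [lra|exact Hhit].
  - destruct (lip_separation v F t' w L); auto; [lra| |lra].
    apply (exc_right4 w); [lra|exact Hhit].
Qed.

(** If M visited [L] around a crossing of F, G would stay away from [L], and M would shadow the
    transit of F at both ends; the way back is treated in the mirrored fence. *)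
Lemma left_guard_avoids_right L f g m F G M t u u' t' :
  patrolling L f g m F G M -> excursion F L t u u' t' -> 2 + L / f <= t ->
  avoids G 0 t t' -> avoids M L (t - L / f) (t' + L / f).
Proof.
  intros P E Ht HG.
  assert (HL : 0 < L) by (destruct P; lra).
  destruct (excursion_lengths f F L t u u' t') as [El Er]; eauto using pos_f, lip_F.
  destruct (excursion_avoids f F L t u u' t') as [Al Ar]; eauto using pos_f, lip_F.
  assert (Hc : / 2 < L / f) by (destruct P; apply div_gt; lra).
  assert (H1 : avoids M L (t - L / f) u).
  { destruct (one_slow_visitor_right L f g m F G M (t - L / f) u) as [H|H]; auto;
      [lra|].
    exfalso. destruct P, E.
    apply (no_shadowed_transit f m 0 L F M t u); auto; [lra| | |].
    - intros w Hw. split; [apply exc_left0; lra|apply exc_right3; lra].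
    - intros T HT1 HT2. replace (L - 0) with L in HT2 by ring.
      destruct (cov0 0 T) as [w [Hw Hc0]]; [lra|lra|].
      exists w. split; [exact Hw|].
      destruct Hc0 as [?|[?|?]]; auto. exfalso. apply (HG w); [lra|assumption].
    - destruct (cov0 L u) as [w [Hw Hc0]]; [lra|lra|].
      exists w. split; [exact Hw|].
      destruct Hc0 as [?|[?|?]]; auto. exfalso. apply (H w); [lra|assumption]. }
  assert (H2 : avoids M L u' (t' + L / f)).
  { pose proof (exc_tu _ _ _ _ _ _ E) as Etu.
    pose proof (exc_uu _ _ _ _ _ _ E) as Euu.
    destruct (one_slow_visitor_right L f g m F G M u' (t' + L / f)) as [H|H]; auto;
      [lra|].
    exfalso. destruct P, E.
    apply (no_shadowed_transit f m 0 L (fun t => L - F t) (fun t => L - M t) u' t');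
      auto using lip_opp; [lra|lra|lra| | |].
    - intros w Hw. split; intros Hx;
        [apply (exc_right4 w); lra|apply (exc_left0 w); lra].
    - intros T HT1 HT2. replace (L - 0) with L in HT2 by ring.
      destruct (cov0 L T) as [w [Hw Hc0]]; [lra|lra|].
      exists w. split; [exact Hw|].
      destruct Hc0 as [?|[?|?]]; [left; lra| |right; lra].
      exfalso. apply (H w); [lra|assumption].
    - destruct (cov0 0 t') as [w [Hw Hc0]]; [lra|lra|].
      exists w. split; [exact Hw|].
      destruct Hc0 as [?|[?|?]]; [left; lra| |right; lra].
      exfalso. apply (HG w); [lra|assumption]. }
  (* A visit at [r] between [u] and [u'] keeps M from 0 for [L / m] on both sides, and a full unit
     of this lies inside the excursion. *)
  intros r Hr HMr.
  destruct (Rlt_le_dec r u) as [|Hru]; [apply (H1 r); [lra|exact HMr]|].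
  destruct (Rlt_le_dec u' r) as [|Hru']; [apply (H2 r); [lra|exact HMr]|].
  destruct P, E.
  assert (Ec : / 2 < L / m) by (apply div_gt; lra).
  assert (2 < L / f + L / m) by (apply div_sum_gt_2; lra).
  destruct (cov0 0 (Rmin (r + L / m) t')) as [w [Hw Hc0]].
  { lra. }
  { unfold Rmin; destruct Rle_dec; lra. }
  assert (t < w < t' /\ r - L / m < w < r + L / m)
    by (revert Hw; unfold Rmin; destruct Rle_dec; lra).
  destruct Hc0 as [?|[?|?]].
  - apply (exc_left0 w); [lra|assumption].
  - apply (HG w); [lra|assumption].
  - destruct (lip_separation m M r w L); auto; lra.
Qed.

(** * Excluding the faster slow agent as guard of [L] *)

Lemma div2_gt c A B f g :
  0 < f -> 0 < g -> c * (f * g) < A * g + B * f -> c < A / f + B / g.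
Proof.
  intros Hf Hg H.
  replace (A / f + B / g) with ((A * g + B * f) / (f * g)) by (field; lra).
  apply div_gt; [nra|exact H].
Qed.

(* [r1, r2] is an interval between two visits of G to L that contains u and in
   which F alone, between its visits u and u2, keeps L visited. *)
Record dwell (F G : R -> R) (L u u2 r1 r2 : R) : Prop := {
  dw_r1 : u - 1 <= r1 <= u; dw_u : u <= u2; dw_r2 : u2 <= r2 <= u2 + 1;
  dw_Fu : F u = L; dw_Fu2 : F u2 = L; dw_Gr1 : G r1 = L; dw_Gr2 : G r2 = L;
  dw_avoids : avoids G L r1 r2 }.

(** Just before [u] and just before [t' + L / f] neither F nor M is at [L], so G is, which yields
    [r1] and [r2]. After the last visit [u2] of F nobody is at [L] until [r2], so [r2 <= u2 + 1]. *)
Lemma dwell_exists L f g m F G M t u u' t' :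
  patrolling L f g m F G M -> excursion F L t u u' t' -> 2 + L / f <= t ->
  avoids M L (t - L / f) (t' + L / f) ->
  exists u2 r1 r2, dwell F G L u u2 r1 r2 /\ u2 <= u' /\ r2 < t' + L / f.
Proof.
  intros P E Ht HM.
  assert (HL : 0 < L) by (destruct P; lra).
  destruct (excursion_lengths f F L t u u' t') as [El Er]; eauto using pos_f, lip_F.
  destruct (excursion_avoids f F L t u u' t') as [Al Ar]; eauto using pos_f, lip_F.
  assert (Hc : / 2 < L / f) by (destruct P; apply div_gt; lra).
  destruct P, E.
  destruct (cov0 L u) as [w [Hw [H|[H|H]]]]; [lra|lra| | |].
  { exfalso. apply (Al w); [lra|exact H]. }
  2:{ exfalso. apply (HM w); [lra|exact H]. }
  destruct (last_hit g G L w u) as [r1 [Hr1 [HGr1 Hl1]]]; auto; [lra|].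
  destruct (cov0 L (t' + L / f)) as [w' [Hw' [H'|[H'|H']]]]; [lra|lra| | |].
  { exfalso. apply (Ar w'); [lra|exact H']. }
  2:{ exfalso. apply (HM w'); [lra|exact H']. }
  destruct (first_hit g G L u w') as [r2 [Hr2 [HGr2 Hf2]]]; auto; [lra|].
  destruct (last_hit f F L u r2) as [u2 [Hu2 [HFu2 Hl2]]]; auto; [lra|].
  exists u2, r1, r2. split; [constructor; auto; try lra|split; [|lra]].
  - split; [lra|]. apply Rnot_lt_le. intros Hgap.
    destruct (cov0 L r2) as [s [Hs [K|[K|K]]]]; [lra|lra| | |].
    + apply (Hl2 s); [lra|exact K].
    + apply (Hf2 s); [lra|exact K].
    + apply (HM s); [lra|exact K].
  - intros s Hs. destruct (Rle_lt_dec s u); [apply Hl1|apply Hf2]; lra.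
  - apply Rnot_lt_le. intros Hlt. apply (Ar u2); [lra|exact HFu2].
Qed.

(** M alone serves 0 during the excursion; the bounds on [w] ensure that its absence from 0 around a
    visit to [y] contains a unit window inside [(t, t')]. *)
Lemma M_absent L f g m F G M t t' y w :
  patrolling L f g m F G M -> 0 < t -> t + 1 < t' ->
  avoids F 0 t t' -> avoids G 0 t t' -> m / 2 < y ->
  t + 1 - y / m < w < t' - 1 + y / m -> M w <> y.
Proof.
  intros P Ht Htt HF HG Hy Hw HMw. destruct P.
  assert (/ 2 < y / m) by (apply div_gt; lra).
  destruct (cov0 0 (Rmin (w + y / m) t')) as [s [Hs Hc0]].
  { lra. }
  { unfold Rmin; destruct Rle_dec; lra. }
  assert (t < s < t' /\ w - y / m < s < w + y / m)
    by (revert Hs; unfold Rmin; destruct Rle_dec; lra).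
  destruct Hc0 as [?|[?|?]].
  - apply (HF s); [lra|assumption].
  - apply (HG s); [lra|assumption].
  - destruct (lip_separation m M w s y); auto; lra.
Qed.

(** Near [u] and [u2] F is too close to [L] in time to be at [y]; in between, F alone serves [L] and
    cannot go that far. *)
Lemma F_absent L f g m F G M u u2 r1 r2 y w :
  patrolling L f g m F G M -> dwell F G L u u2 r1 r2 -> 1 <= u ->
  avoids M L (u - 1) r2 -> f / 2 < L - y ->
  u - (L - y) / f < w < u2 + (L - y) / f -> F w <> y.
Proof.
  intros P [] Hu1 HM Hy Hw HFw. destruct P.
  assert (/ 2 < (L - y) / f) by (apply div_gt; lra).
  destruct (lip_separation f F u w (L - y)); auto; [lra|lra|].
  destruct (lip_separation f F u2 w (L - y)); auto; [lra| |lra].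
  destruct (cov0 L (w + / 2)) as [s [Hs [K|[K|K]]]]; [lra|lra| | |].
  - destruct (lip_separation f F w s (L - y)); auto; lra.
  - apply (dw_avoids0 s); [lra|exact K].
  - apply (HM s); [lra|exact K].
Qed.

(** The last two hypotheses make the absences of M and F from [y] overlap for a unit of time, so G
    must step in, coming from [L] after [r1] and returning by [r2]. This bounds the dwell from
    below. *)
Lemma G_visits L f g m F G M t u t' u2 r1 r2 y :
  patrolling L f g m F G M -> dwell F G L u u2 r1 r2 ->
  1 <= t -> t + 1 < t' -> t + L / f <= u -> u2 + L / f <= t' ->
  avoids F 0 t t' -> avoids G 0 t t' -> avoids M L (u - 1) r2 ->
  m / 2 < y -> f / 2 < L - y -> 3 < t' - t + 2 * (y / m) ->
  2 < L / f + (u2 - u) + y / m + (L - y) / f ->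
  exists w, G w = y /\ t + 1 - y / m < w < t' - 1 + y / m /\
    r1 + (L - y) / g <= w <= r2 - (L - y) / g.
Proof.
  intros P DW Ht Htt Hl Hr HF HG HM Hy HyL C1 C2.
  assert (E : / 2 < (L - y) / f) by (destruct P; apply div_gt; lra).
  assert (E2 : (L - y) / f <= (L - y) / g)
    by (destruct P; apply div_antimono; lra).
  assert (E3 : (L - y) / f <= L / f).
  { destruct P. apply Rmult_le_compat_r; [apply Rlt_le, Rinv_0_lt_compat|]; lra. }
  pose proof (dw_r1 _ _ _ _ _ _ _ DW). pose proof (dw_u _ _ _ _ _ _ _ DW).
  pose proof (dw_r2 _ _ _ _ _ _ _ DW).
  destruct (cov _ _ _ _ _ _ _ P y (Rmin (t' - 1 + y / m) (u2 + (L - y) / f)))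
    as [w [Hw Hc]].
  { destruct P; lra. }
  { unfold Rmin; destruct Rle_dec; lra. }
  assert (Hw1 : t + 1 - y / m < w < t' - 1 + y / m)
    by (revert Hw; unfold Rmin; destruct Rle_dec; lra).
  assert (Hw2 : u - (L - y) / f < w < u2 + (L - y) / f)
    by (revert Hw; unfold Rmin; destruct Rle_dec; lra).
  destruct Hc as [K|[K|K]].
  - exfalso. revert K.
    apply (F_absent L f g m F G M u u2 r1 r2); auto; lra.
  - exists w. split; [exact K|]. split; [exact Hw1|].
    destruct P, DW.
    (* Since [g <= f], a visit before [r1] or after [r2] would fall outside the absence interval of
       F. *)
    destruct (lip_separation g G r1 w (L - y)); auto; [lra|lra|].
    destruct (lip_separation g G r2 w (L - y)); auto; lra.
  - exfalso. revert K.
    apply (M_absent L f g m F G M t t'); auto; lra.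
Qed.

(* A visit of G to y1 = m / 2 + e during the dwell leaves
   y2 = (g + m) / 2 + 2 e unvisited for a unit of time. *)
Lemma G_not_near_left L f g m F G M t u t' u2 r1 r2 e w :
  patrolling L f g m F G M -> m <= g -> dwell F G L u u2 r1 r2 ->
  2 <= t -> t + 1 < t' -> t + L / f <= u ->
  avoids F 0 t t' -> avoids G 0 t t' -> avoids M L (u - 1) r2 ->
  0 < e -> (f + g + m) / 2 + 2 * e < L -> G w = m / 2 + e ->
  t + 1 - (m / 2 + e) / m < w < t' - 1 + (m / 2 + e) / m ->
  r1 + (L - (m / 2 + e)) / g <= w <= r2 - (L - (m / 2 + e)) / g -> False.
Proof.
  intros P Hmg DW Ht Htt Hl HF HG HM He HeL HGw Hw1 Hw2.
  set (y2 := (g + m) / 2 + 2 * e).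
  assert (HLf : / 2 < L / f) by (destruct P; apply div_gt; lra).
  assert (E1 : / 2 < (L - y2) / f) by (unfold y2; destruct P; apply div_gt; lra).
  assert (E2 : / 2 < (g / 2 + e) / g) by (destruct P; apply div_gt; lra).
  assert (E3 : 1 < (L - (m / 2 + e)) / g) by (destruct P; apply div_gt; lra).
  assert (E4 : (m / 2 + e) / m = / 2 + e / m) by (destruct P; field; lra).
  (* As [m <= g], the absence interval of M for [y2] exceeds that for [m / 2 + e] by more than 1/2
     on each side, enough for the unit window around [w]. *)
  assert (E5 : 1 + 2 * (e / m) <= y2 / m).
  { replace (y2 / m) with (/ 2 + g / m / 2 + 2 * (e / m))
      by (unfold y2; destruct P; field; lra).
    assert (1 <= g / m) by (destruct P; apply div_ge; lra). lra. }
  assert (E6 : 0 < e / m) by (destruct P; apply Rdiv_lt_0_compat; lra).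
  pose proof (dw_r1 _ _ _ _ _ _ _ DW). pose proof (dw_u _ _ _ _ _ _ _ DW).
  pose proof (dw_r2 _ _ _ _ _ _ _ DW).
  destruct (cov _ _ _ _ _ _ _ P y2 (w + / 2)) as [s [Hs [K|[K|K]]]].
  { unfold y2; destruct P; lra. }
  { lra. }
  - destruct P, DW.
    destruct (cov0 L (s + / 2)) as [s' [Hs' [K'|[K'|K']]]]; [lra|lra| | |].
    + destruct (lip_separation f F s s' (L - y2)); auto; lra.
    + apply (dw_avoids0 s'); [lra|exact K'].
    + apply (HM s'); [lra|exact K'].
  - destruct P.
    destruct (lip_separation g G w s (g / 2 + e)); auto; unfold y2 in *; lra.
  - revert K. apply (M_absent L f g m F G M t t'); auto; try lra.
    unfold y2; destruct P; lra.
Qed.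

(** If the excursion lasts at least 2, G must visit [m / 2 + e] and [G_not_near_left] applies. If it
    is shorter, the dwell forced by a visit of G, together with two crossings of F, outlasts the
    excursion. *)
Lemma faster_right_guard_impossible L f g m F G M t u u' t' :
  patrolling L f g m F G M -> m <= g -> excursion F L t u u' t' ->
  2 + L / f <= t -> avoids G 0 t t' ->
  avoids M L (t - L / f) (t' + L / f) -> False.
Proof.
  intros P Hmg E Ht HG HM.
  assert (HL : 0 < L) by (destruct P; lra).
  destruct (excursion_lengths f F L t u u' t') as [El Er]; eauto using pos_f, lip_F.
  assert (HLf : / 2 < L / f) by (destruct P; apply div_gt; lra).
  destruct (dwell_exists L f g m F G M t u u' t') as [u2 [r1 [r2 [DW [Hu2 Hr2]]]]];
    auto.
  assert (HF : avoids F 0 t t') by (destruct E; assumption).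
  pose proof (exc_uu _ _ _ _ _ _ E) as Huu.
  pose proof (dw_r1 _ _ _ _ _ _ _ DW) as Hr1.
  pose proof (dw_u _ _ _ _ _ _ _ DW) as Hd.
  pose proof (dw_r2 _ _ _ _ _ _ _ DW) as Hr2'.
  assert (HM' : avoids M L (u - 1) r2) by (intros w Hw; apply HM; lra).
  assert (V : forall y, m / 2 < y -> f / 2 < L - y ->
    3 < t' - t + 2 * (y / m) ->
    2 < L / f + (u2 - u) + y / m + (L - y) / f ->
    exists w, G w = y /\ t + 1 - y / m < w < t' - 1 + y / m /\
      r1 + (L - y) / g <= w <= r2 - (L - y) / g).
  { intros y Y1 Y2 Y3 Y4.
    apply (G_visits L f g m F G M t u t' u2 r1 r2 y); auto; lra. }
  set (e := (L - (f + g + m) / 2) / 4).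
  assert (He : 0 < e) by (unfold e; destruct P; lra).
  assert (EL : L = (f + g + m) / 2 + 4 * e) by (unfold e; lra).
  assert (Pos : 0 < f /\ 0 < g /\ 0 < m /\ g <= f)
    by (destruct P; tauto).
  destruct Pos as [Pf [Pg [Pm Pgf]]].
  assert (Hem : 0 < e / m) by (apply Rdiv_lt_0_compat; lra).
  (* From a visit of G to [m]; the 2 comes from [r1 >= u - 1] and [r2 <= u2 + 1]. *)
  assert (Hfast : 2 * g < f -> 2 * ((L - m) / g) - 2 <= u2 - u).
  { intros _. destruct (V m) as [w [_ [_ Hw]]]; [lra|lra| | |lra].
    - replace (m / m) with 1 by (field; lra). lra.
    - replace (m / m) with 1 by (field; lra).
      replace (L / f + (u2 - u) + 1 + (L - m) / f)
        with ((2 * L - m) / f + (u2 - u) + 1) by (field; lra).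
      assert (1 < (2 * L - m) / f) by (apply div_gt; lra). lra. }
  assert (Hfast2 : 2 * g < f -> 4 < 2 * (L / f) + 2 * ((L - m) / g)).
  { intros Hgf.
    replace (2 * (L / f) + 2 * ((L - m) / g))
      with (2 * L / f + 2 * (L - m) / g) by (field; lra).
    apply div2_gt; [lra|lra|]. rewrite EL.
    assert (0 <= (f - g) * (f - g - m)) by (apply Rmult_le_pos; lra).
    nra. }
  destruct (Rle_lt_dec 2 (t' - t)) as [Htau|Htau].
  - destruct (V (m / 2 + e)) as [w [Hw [Hw1 Hw2]]]; [lra|lra| | |].
    + replace ((m / 2 + e) / m) with (/ 2 + e / m) by (field; lra). lra.
    + replace (L / f + (u2 - u) + (m / 2 + e) / m + (L - (m / 2 + e)) / f)
        with ((2 * L - m / 2 - e) / f + (u2 - u) + / 2 + e / m) by (field; lra).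
      (* For a much faster F, crossing times may be too short for the overlap, and the dwell bound
         [Hfast] makes up for it. *)
      destruct (Rlt_le_dec (2 * g) f) as [Hgf|Hgf].
      * specialize (Hfast Hgf).
        assert (7 / 2 < (2 * L - m / 2 - e) / f + (2 * (L - m)) / g).
        { apply div2_gt; [lra|lra|]. rewrite EL.
          assert (0 <= (2 * f - 3 * g) * (f - g)) by (apply Rmult_le_pos; lra).
          assert (0 <= (g - m) * (2 * f - g)) by (apply Rmult_le_pos; lra).
          nra. }
        replace (2 * (L - m) / g) with (2 * ((L - m) / g)) in * by (field; lra).
        lra.
      * assert (3 / 2 < (2 * L - m / 2 - e) / f) by (apply div_gt; lra). lra.
    + apply (G_not_near_left L f g m F G M t u t' u2 r1 r2 e w); auto; lra.
  - destruct (Rlt_le_dec (2 * g) f) as [Hgf|Hgf].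
    { specialize (Hfast Hgf). specialize (Hfast2 Hgf). lra. }
    (* The least y > m / 2 that M, bound to visit 0, leaves to F and G for a
       unit of time. *)
    set (tau := t' - t) in *.
    assert (Htau1 : 1 < tau) by (unfold tau; lra).
    set (y := m / 2 + (m * (2 - tau) / 2 + e)).
    assert (Ey : y / m = 3 / 2 - tau / 2 + e / m) by (unfold y; field; lra).
    assert (Y1 : 0 < m * (2 - tau)) by (apply Rmult_lt_0_compat; lra).
    assert (Y2 : 0 < m * (tau - 1)) by (apply Rmult_lt_0_compat; lra).
    assert (Y3 : 0 < f * (2 - tau)) by (apply Rmult_lt_0_compat; lra).
    destruct (V y) as [w [_ [_ Hw]]].
    + unfold y; lra.
    + unfold y; lra.
    + rewrite Ey. lra.
    + rewrite Ey.
      replace (L / f + (u2 - u) + (3 / 2 - tau / 2 + e / m) + (L - y) / f)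
        with ((2 * L - y) / f + (u2 - u) + 3 / 2 - tau / 2 + e / m)
        by (field; lra).
      assert ((1 + tau) / 2 < (2 * L - y) / f)
        by (apply div_gt; [lra|unfold y; lra]).
      lra.
    + assert (tau + 2 < 2 * L / f + 2 * (L - y) / g).
      { apply div2_gt; [lra|lra|].
        assert (0 <= (2 - tau) * f * (g - m))
          by (apply Rmult_le_pos; [apply Rmult_le_pos|]; lra).
        assert (0 <= (f - g) ^ 2) by apply pow2_ge_0.
        assert (0 < e * g) by (apply Rmult_lt_0_compat; lra).
        assert (0 < e * f) by (apply Rmult_lt_0_compat; lra).
        assert (0 < g * m) by (apply Rmult_lt_0_compat; lra).
        unfold y. rewrite EL. nra. }
      replace (2 * L / f) with (2 * (L / f)) in * by (field; lra).
      replace (2 * (L - y) / g) with (2 * ((L - y) / g)) in * by (field; lra).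
      unfold tau in *. lra.
Qed.

(** * Contradiction from two overlapping excursions *)

Lemma excursion_guards L f g m F G M t u u' t' :
  patrolling L f g m F G M -> m <= g -> excursion F L t u u' t' ->
  2 + L / f <= t ->
  avoids M 0 t t' /\ avoids G L (t - L / f) (t' + L / f).
Proof.
  intros P Hmg E Ht.
  assert (HLf : 0 < L / f) by (destruct P; apply Rdiv_lt_0_compat; lra).
  destruct (one_slow_visitor L f g m F G M t t') as [H|H]; auto.
  - lra.
  - destruct E; assumption.
  - exfalso.
    apply (faster_right_guard_impossible L f g m F G M t u u' t'); auto.
    apply (left_guard_avoids_right L f g m F G M t u u' t'); auto.
  - split; [exact H|].
    apply (left_guard_avoids_right L f m g F M G t u u' t');
      auto using patrolling_swap.
Qed.

(** An excursion from 0 keeps G from [L] until [t' + L / f]; the mirrored excursion around [t']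
    keeps M and F from [L] between [s] and [s']. These absences overlap for more than a unit of
    time. *)
Lemma not_patrolling L f g m F G M :
  m <= g -> patrolling L f g m F G M -> False.
Proof.
  intros Hmg P.
  assert (HL : 0 < L) by (destruct P; lra).
  assert (HLf : / 2 < L / f) by (destruct P; apply div_gt; lra).
  destruct (F_visits_left L f g m F G M (2 + L / f)) as [t0 [Ht0 HFt0]]; auto; [lra|].
  destruct (F_visits_right L f g m F G M t0) as [u0 [Hu0 HFu0]]; auto; [lra|].
  destruct (F_visits_left L f g m F G M u0) as [t1 [Ht1 HFt1]]; auto; [lra|].
  destruct (F_visits_right L f g m F G M t1) as [u1 [Hu1 HFu1]]; auto; [lra|].
  destruct (excursion_exists f F L t0 u0 t1) as [t [u [u' [t' [E [B1 [B2 B3]]]]]]];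
    eauto using pos_f, lip_F; [lra|].
  pose proof (patrolling_reflect _ _ _ _ _ _ _ P) as P'.
  pose proof (exc_tu _ _ _ _ _ _ E) as Htu.
  pose proof (exc_uu _ _ _ _ _ _ E) as Huu.
  pose proof (exc_ut _ _ _ _ _ _ E) as Hut.
  pose proof (exc_u' _ _ _ _ _ _ E) as HFu'.
  pose proof (exc_t' _ _ _ _ _ _ E) as HFt'.
  destruct (excursion_exists f (fun w => L - F w) L u' t' u1)
    as [s [q [q' [s' [E' [C1 [C2 C3]]]]]]]; eauto using pos_f, lip_F; try lra.
  destruct (excursion_guards L f g m F G M t u u' t') as [_ HG]; auto; [lra|].
  destruct (excursion_guards L f g m _ _ _ s q q' s' P') as [HM _]; auto; [lra|].
  destruct (excursion_lengths f (fun w => L - F w) L s q q' s') as [D1 D2];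
    eauto using pos_f, lip_F.
  destruct P, E'.
  assert (D3 : s + L / f <= t').
  { destruct (lip_separation f F s t' L); auto; lra. }
  destruct (cov0 L (Rmin s' (t' + L / f))) as [w [Hw H]].
  { lra. }
  { unfold Rmin; destruct Rle_dec; lra. }
  assert (Hw' : s < w < s' /\ w < t' + L / f)
    by (revert Hw; unfold Rmin; destruct Rle_dec; lra).
  destruct H as [H|[H|H]].
  - apply (exc_left0 w); lra.
  - apply (HG w); [lra|exact H].
  - apply (HM w); lra.
Qed.

(** * From strategies to Lipschitz motions *)

Lemma motion_extends_lip l v a :
  0 < v -> motion l v a -> lip v (fun t => a (Rmax t 0)).
Proof.
  intros Hv [_ H].
  assert (K : forall s t, 0 <= s -> s <= t -> Rabs (a s - a t) <= v * (t - s)).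
  { intros s t Hs [Hst| ->].
    - replace (a t) with (a (s + (t - s))) by (f_equal; ring). apply H; lra.
    - replace (a t - a t) with 0 by ring. rewrite Rabs_R0. lra. }
  assert (K' : forall s t, s <= t ->
    Rabs (a (Rmax s 0) - a (Rmax t 0)) <= v * (t - s)).
  { intros s t Hst. apply Rle_trans with (v * (Rmax t 0 - Rmax s 0)).
    - apply K; unfold Rmax; repeat destruct Rle_dec; lra.
    - apply Rmult_le_compat_l; [lra|].
      unfold Rmax; repeat destruct Rle_dec; lra. }
  intros s t. destruct (Rle_lt_dec s t).
  - rewrite (Rabs_left1 (s - t)) by lra. replace (- (s - t)) with (t - s) by ring.
    apply K'; assumption.
  - rewrite Rabs_minus_sym, (Rabs_right (s - t)) by lra. apply K'; lra.
Qed.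

Theorem theorem4 (v : nat -> R) (l : R) :
  0 < v 0%nat -> 0 < v 1%nat -> 0 < v 2%nat ->
  l > (v 0%nat + v 1%nat + v 2%nat) / 2 ->
  ~ exists a : nat -> R -> R, strategy 3 l v a /\ patrols 3 l a.
Proof.
  intros V0 V1 V2 Hl [a [Hs Hp]].
  set (b := fun i t => a i (Rmax t 0)).
  assert (B : forall i, (i < 3)%nat -> 0 < v i -> lip (v i) (b i)).
  { intros i Hi Hv. apply (motion_extends_lip l); auto. }
  assert (B0 := B 0%nat ltac:(auto) V0).
  assert (B1 := B 1%nat ltac:(auto) V1).
  assert (B2 := B 2%nat ltac:(auto) V2).
  assert (C : forall x T, 0 <= x <= l -> 1 <= T ->
    exists w, T - 1 <= w < T /\ (b 0%nat w = x \/ b 1%nat w = x \/ b 2%nat w = x)).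
  { intros x T Hx HT. destruct (Hp x T Hx HT) as [i [Hi [w [Hw H]]]].
    exists w. split; [exact Hw|]. unfold b. rewrite Rmax_left by lra.
    destruct i as [|[|[|i]]]; auto. exfalso. lia. }
  (* The agents [i], [j], [k], in order of decreasing speed, play F, G and M. *)
  assert (S : forall i j k, 0 < v i -> 0 < v j -> 0 < v k ->
    lip (v i) (b i) -> lip (v j) (b j) -> lip (v k) (b k) ->
    v j <= v i -> v k <= v j -> (v i + v j + v k) / 2 < l ->
    (forall x T, 0 <= x <= l -> 1 <= T ->
      exists w, T - 1 <= w < T /\ (b i w = x \/ b j w = x \/ b k w = x)) -> False).
  { intros i j k. intros.
    apply (not_patrolling l (v i) (v j) (v k) (b i) (b j) (b k)); [assumption|].
    constructor; auto; lra. }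
  destruct (Rle_lt_dec (v 0%nat) (v 1%nat)), (Rle_lt_dec (v 1%nat) (v 2%nat)),
    (Rle_lt_dec (v 0%nat) (v 2%nat)); try lra;
    [ apply (S 2 1 0)%nat | apply (S 1 2 0)%nat | apply (S 1 0 2)%nat
    | apply (S 2 0 1)%nat | apply (S 0 2 1)%nat | apply (S 0 1 2)%nat ];
    auto; try lra;
    intros x T Hx HT; destruct (C x T Hx HT) as [w [Hw H]]; exists w; tauto.
Qed.
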